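(* Let $f\in Bicom(X)$. Then $f$ is a Lie element if and only if $D(head(f))=f$.
   Context: All algebras are over a field $\mathbf{K}$ of characteristic $0$. An algebra over $\mathbf{K}$ (not necessarily associative or unital) is bicommutative if it satisfies $a(bc)=b(ac)$ and $(ab)c=(ac)b$. Let $X=\{x_1,x_2,\dots\}$ be an ordered set of generators with $x_1<x_2<\cdots$, and let $Bicom(X)$ be the free bicommutative algebra over $\mathbf{K}$ generated by $X$. Base elements: for $a_1,\dots,a_k,b_1,\dots,b_l\in X$ with $k,l\ge 1$, put $$e(a_1,\dots,a_k;\,b_1,\dots,b_l)=a_k(\cdots(a_2((\cdots((a_1b_1)b_2)\cdots)b_l))\cdots).$$ This is represented by the hook Young diagram with first column $a_1,\dots,a_k$ and first row $a_1,b_1,\dots,b_l$. It is known that the elements of $X$ together with all $e(a_1,\dots,a_k;b_1,\dots,b_l)$ with $k,l\ge 1$, $a_1\le\dots\le a_k$ and $b_1\le\dots\le b_l$ form a linear basis of $Bicom(X)$; its elements are called base elements. Put $[a,b]=ab-ba$. An element of $Bicom(X)$ is called Lie if it belongs to $L(X)$, the smallest linear subspace of $Bicom(X)$ that contains $X$ and is closed under $[\cdot,\cdot]$ (that is, if it can be expressed by elements of $X$ in terms of commutators). Dynkin map: $D:Bicom(X)\to Bicom(X)$ is the linear map defined on base elements $e(a_1,\dots,a_k;b_1,\dots,b_l)$, $k+l=n$ (with $a_1\le\dots\le a_k$, $b_1\le\dots\le b_l$), by $$D\big(e(a_1,\dots,a_k;b_1,\dots,b_l)\big)=\tfrac12\,[a_k,[\cdots[a_2,[[\cdots[[a_1,b_1],b_2]\cdots],b_l]]\cdots]].$$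 Head: for $f\in Bicom(X)$, $head(f)$ is the projection of $f$ (along the remaining base elements) to the linear span of those base elements $e(a_1,\dots,a_k;b_1,\dots,b_l)$, of degree $n=k+l$, for which either $k=1$ and $b_1=x_1$ (diagram of shape $(n)$ with $x_1$ in the second column), or $l=1$ and $a_1=x_1$ (diagram of shape $(2,1^{n-2})$ with $x_1$ in the first column, in its top box).
   Formalization: The claim fails for Lie elements such as x_2 or [x_2,x_3], whose head is 0; it is proved instead that D(head(f))=f iff f is Lie and lies in the span of the base elements of degree at least 2 in which x_1 occurs. *)

(* Defs.v *)
From HB Require Import structures.
From mathcomp Require Import all_boot all_order all_algebra.
From mathcomp Require Import finmap.
From mathcomp.multinomials Require Import monalg.

Set Implicit Arguments.
Unset Strict Implicit.
Unset Printing Implicit Defensive.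

Import GRing.Theory.
Local Open Scope ring_scope.

HB.mixin Record Lmodule_isBicomAlg (K : fieldType) B of GRing.Lmodule K B := {
  bmul : B -> B -> B;
  bmul_linearl : forall v : B, linear (bmul^~ v);
  bmul_linearr : forall u : B, linear (bmul u);
  bmulCA : forall a b c : B, bmul a (bmul b c) = bmul b (bmul a c);
  bmulAC : forall a b c : B, bmul (bmul a b) c = bmul (bmul a c) b
}.

#[short(type="bicomAlgType")]
HB.structure Definition BicomAlg (K : fieldType) :=
  {B of GRing.Lmodule K B & Lmodule_isBicomAlg K B}.

Definition bcomm (K : fieldType) (B : bicomAlgType K) (a b : B) : B :=
  bmul a b - bmul b a.

Definition bicom_hom (K : fieldType) (B A : bicomAlgType K)
    (phi : {linear B -> A}) : Prop :=
  forall u v : B, phi (bmul u v) = bmul (phi u) (phi v).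

(* [free_bicom x]: B is the free bicommutative algebra on the family x.
   Generators are numbered from 0, so that x 0 < x 1 < ... are the x_1 < x_2 <
   ... of the mathematical text, ordered as their indices. *)
Definition free_bicom (K : fieldType) (B : bicomAlgType K) (x : nat -> B) :
    Prop :=
  (forall (A : bicomAlgType K) (y : nat -> A),
     exists2 phi : {linear B -> A}, bicom_hom phi & forall i, phi (x i) = y i)
  /\
  (forall (A : bicomAlgType K) (phi psi : {linear B -> A}),
     bicom_hom phi -> bicom_hom psi -> (forall i, phi (x i) = psi (x i)) ->
     phi =1 psi).

(* For (a_1, ..., a_k) = (a1, a) and (b_1, ..., b_l) = (b1, b), this is
   a_k (... (a_2 ((... ((a_1 b_1) b_2) ...) b_l)) ...) for the operation op;
   the lists of indices are nonempty by construction, k = (size a).+1 and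
   l = (size b).+1. *)
Definition hook_word (B : Type) (op : B -> B -> B) (x : nat -> B)
    (a1 : nat) (a : seq nat) (b1 : nat) (b : seq nat) : B :=
  foldl (fun u c => op (x c) u)
    (foldl (fun u d => op u (x d)) (op (x a1) (x b1)) b) a.

Definition hook (K : fieldType) (B : bicomAlgType K) (x : nat -> B) :=
  hook_word (@bmul K B) x.

Definition lie_hook (K : fieldType) (B : bicomAlgType K) (x : nat -> B) :=
  hook_word (@bcomm K B) x.

Definition base_index (a1 : nat) (a : seq nat) (b1 : nat) (b : seq nat) :
    bool :=
  path leq a1 a && path leq b1 b.

Inductive is_lie (K : fieldType) (B : bicomAlgType K) (x : nat -> B) :
    B -> Prop :=
| lie_gen i : is_lie x (x i)
| lie_zero : is_lie x 0
| lie_add u v : is_lie x u -> is_lie x v -> is_lie x (u + v)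
| lie_scale c u : is_lie x u -> is_lie x (c *: u)
| lie_bracket u v : is_lie x u -> is_lie x v -> is_lie x (bcomm u v).

(* No value is imposed on the generators, where the Dynkin map is not
   specified. *)
Definition is_dynkin (K : fieldType) (B : bicomAlgType K) (x : nat -> B)
    (D : {linear B -> B}) : Prop :=
  forall a1 a b1 b, base_index a1 a b1 b ->
    D (hook x a1 a b1 b) = 2%:R^-1 *: lie_hook x a1 a b1 b.

(* (k = 1 and b_1 = x_1) or (l = 1 and a_1 = x_1) *)
Definition head_index (a1 : nat) (a : seq nat) (b1 : nat) (b : seq nat) :
    bool :=
  (a == [::]) && (b1 == 0%N) || (b == [::]) && (a1 == 0%N).

Definition is_head (K : fieldType) (B : bicomAlgType K) (x : nat -> B)
    (head : {linear B -> B}) : Prop :=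
  (forall i, head (x i) = 0) /\
  (forall a1 a b1 b, base_index a1 a b1 b ->
     head (hook x a1 a b1 b) =
       if head_index a1 a b1 b then hook x a1 a b1 b else 0).

(* [involves_first x f]: f lies in the span of the base elements of degree at
   least 2 in which the first generator x_1 occurs; as the indices of a base
   element are sorted, x_1 occurs iff it is a_1 or b_1.  Without this condition
   a Lie element f need not satisfy D (head f) = f: the head of [x_2, x_3] and
   the head of a generator are both 0. *)
Inductive involves_first (K : fieldType) (B : bicomAlgType K) (x : nat -> B) :
    B -> Prop :=
| inv_base a1 a b1 b : base_index a1 a b1 b -> (a1 == 0%N) || (b1 == 0%N) ->
    involves_first x (hook x a1 a b1 b)
| inv_zero : involves_first x 0
| inv_add u v : involves_first x u -> involves_first x v ->
    involves_first x (u + v)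
| inv_scale c u : involves_first x u -> involves_first x (c *: u).

(* The hypotheses on B, D and head are consistent: below, a free bicommutative
   algebra is constructed, the base elements are shown to form a basis of any
   free bicommutative algebra, and D and head are shown to exist. *)

Section Words.
Context (K : fieldType) (B : bicomAlgType K) (x : nat -> B).
Local Infix "**" := (@bmul K B) (at level 40, left associativity).

Definition lmuls (a : seq nat) (u : B) := foldl (fun u c => x c ** u) u a.
Definition rmuls (b : seq nat) (u : B) := foldl (fun u d => u ** x d) u b.

Definition hookS (a b : seq nat) : B :=
  if a is a1 :: a' then lmuls a' (rmuls b (x a1)) else 0.

Lemma hookE a1 a b1 b : hook x a1 a b1 b = hookS (a1 :: a) (b1 :: b).
Proof. by []. Qed.

Lemma foldl_perm (T : Type) (f : T -> nat -> T) (u : T) s t :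
  (forall v c d, f (f v c) d = f (f v d) c) -> perm_eq s t ->
  foldl f u s = foldl f u t.
Proof.
move=> fC; elim: s t u => [|c s IH] t u pst.
  by move: pst; rewrite perm_sym => /perm_nilP ->.
have ct : c \in t by rewrite -(perm_mem pst) mem_head.
case/splitPr: ct pst => t1 t2; rewrite perm_sym -cat1s perm_catCA /= perm_cons.
rewrite perm_sym => /IH IH' /=; rewrite IH' !foldl_cat /=; congr foldl.
by elim: t1 u {IH'} => //= d t1 IHt u; rewrite fC IHt.
Qed.

Lemma lmuls_perm a a' u : perm_eq a a' -> lmuls a u = lmuls a' u.
Proof. by apply: foldl_perm => v c d; rewrite bmulCA. Qed.

Lemma rmuls_perm b b' u : perm_eq b b' -> rmuls b u = rmuls b' u.
Proof. by apply: foldl_perm => v c d; rewrite bmulAC. Qed.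

Lemma bmul_assoc a u v b : a ** (u ** v ** b) = (a ** (u ** v)) ** b.
Proof. by rewrite (bmulAC u v b) [LHS]bmulCA (bmulCA a u v) [RHS]bmulAC. Qed.

Lemma bmul_rmuls a u v b : a ** rmuls b (u ** v) = rmuls b (a ** (u ** v)).
Proof.
elim: b u v => //= d b IH u v; rewrite IH; congr rmuls; exact: bmul_assoc.
Qed.

Lemma bmul_lmuls a c u : a ** lmuls c u = lmuls c (a ** u).
Proof. by elim: c u => //= d c IH u; rewrite IH bmulCA. Qed.

Lemma rmuls_prod b u v : exists u' v', rmuls b (u ** v) = u' ** v'.
Proof. by elim: b u v => [|d b IH] u v; [exists u, v | exact: IH]. Qed.

Lemma lmuls_rmuls a b u v :
  rmuls b (lmuls a (u ** v)) = lmuls a (rmuls b (u ** v)).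
Proof.
elim: a u v => //= c a IH u v; rewrite IH; congr lmuls.
by rewrite -bmul_rmuls.
Qed.

Lemma hookS_permr a b b' : perm_eq b b' -> hookS a b = hookS a b'.
Proof. by case: a => //= a1 a pb; rewrite (rmuls_perm _ pb). Qed.

Lemma hookS_swap a1 a2 a b : b != [::] ->
  hookS [:: a1, a2 & a] b = hookS [:: a2, a1 & a] b.
Proof.
case: b => // b1 b _ /=; congr lmuls.
by rewrite !bmul_rmuls bmulCA.
Qed.

Lemma hookS_perml a a' b : b != [::] -> perm_eq a a' -> hookS a b = hookS a' b.
Proof.
move=> b0; case: a a' => [|a1 a] a' pa.
  by move: pa; rewrite perm_sym => /perm_nilP ->.
case: a' pa => [/perm_nilP //|a2 a'] pa.
have [e|ne] := eqVneq a1 a2.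
  by subst a2; move: pa; rewrite perm_cons => /= /lmuls_perm ->.
have a2a : a2 \in a.
  by have := perm_mem pa a2; rewrite mem_head inE eq_sym (negPf ne).
have pr : perm_eq a (a2 :: rem a2 a) by exact: perm_to_rem.
have pr' : perm_eq a' (a1 :: rem a2 a).
  rewrite -(perm_cons a2) -(permPl pa) -[a2 :: a1 :: _]cat1s -[a1 :: rem _ _]cat1s.
  by rewrite perm_sym perm_catCA /= perm_cons perm_sym.
rewrite /= (lmuls_perm _ pr) (lmuls_perm _ pr').
exact: (@hookS_swap a1 a2 _ b).
Qed.

Lemma gen_mul_hookS i a b : a != [::] -> b != [::] ->
  x i ** hookS a b = hookS (i :: a) b.
Proof.
move=> a0 b0; have -> : hookS (i :: a) b = hookS (rcons a i) b.
  by apply: hookS_perml => //; rewrite perm_sym perm_rcons.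
by case: a a0 => // a1 a _; rewrite /= /lmuls foldl_rcons.
Qed.

Lemma hookS_mul_gen j a b : a != [::] -> b != [::] ->
  hookS a b ** x j = hookS a (rcons b j).
Proof.
case: a => // a1 a _; case: b => // b1 b _ /=.
have -> : forall u, u ** x j = rmuls [:: j] u by [].
have [u [v e]] := rmuls_prod b (x a1) (x b1).
by rewrite e lmuls_rmuls -e /rmuls foldl_rcons.
Qed.

Lemma hookS_mul_hookS a b c d : a != [::] -> b != [::] -> c != [::] ->
  d != [::] -> hookS a b ** hookS c d = hookS (a ++ c) (b ++ d).
Proof.
case: a => // a1 a _; case: b => // b1 b _.
case: c => // c1 c _; case: d => // d1 d _.
rewrite [hookS (c1 :: c) _]/= bmul_lmuls bmul_rmuls bmulCA -bmul_rmuls.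
set p := hookS _ _.
have -> : rmuls d (p ** x d1) = rmuls (d1 :: d) p by [].
rewrite /p /=.
have [u [v e]] := rmuls_prod b (x a1) (x b1).
have -> : forall w, rmuls d (w ** x d1) = rmuls (d1 :: d) w by [].
rewrite e lmuls_rmuls -e /lmuls /rmuls !foldl_cat /=; congr foldl.
Qed.

End Words.

Lemma hook_word_hom (K : fieldType) (B A : bicomAlgType K)
    (phi : {linear B -> A}) (x : nat -> B) (y : nat -> A) :
  bicom_hom phi -> (forall i, phi (x i) = y i) ->
  forall a b, phi (hookS x a b) = hookS y a b.
Proof.
move=> phiM phix [|a1 a] b; first by rewrite /= linear0.
have R : forall b u, phi (rmuls x b u) = rmuls y b (phi u).
  by elim=> //= d s IH u; rewrite IH phiM phix.
have L : forall a u, phi (lmuls x a u) = lmuls y a (phi u).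
  by elim=> //= d s IH u; rewrite IH phiM phix.
by rewrite /= L R phix.
Qed.

Section LinearExtension.
Context (K : fieldType) (T : choiceType) (V : lmodType K).

Definition lext (h : T -> V) (g : {malg K[T]}) : V :=
  \sum_(k <- msupp g) g@_k *: h k.

Lemma lextEw h (g : {malg K[T]}) (S : {fset T}) :
  (msupp g `<=` S)%fset -> lext h g = \sum_(k <- S) g@_k *: h k.
Proof.
move=> gS; rewrite /lext; apply: big_fset_incl => // k _ kg.
by rewrite mcoeff_outdom // scale0r.
Qed.

Lemma lext_is_linear h : linear (lext h).
Proof.
move=> c u v; pose S := (msupp u `|` msupp v)%fset.
have Su : (msupp u `<=` S)%fset by apply: fsubsetUl.
have Sv : (msupp v `<=` S)%fset by apply: fsubsetUr.
have Suv : (msupp (c *: u + v) `<=` S)%fset.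
  apply: fsubset_trans (msuppD_le _ _) _; apply: fsetUSS => //.
  exact: msuppZ_le.
rewrite (lextEw h Su) (lextEw h Sv) (lextEw h Suv) scaler_sumr -big_split.
by apply: eq_bigr => k _; rewrite /= mcoeffD mcoeffZ scalerDl scalerA.
Qed.

HB.instance Definition _ h :=
  GRing.isLinear.Build K {malg K[T]} V *:%R (lext h) (lext_is_linear h).

Lemma lextU h k : lext h << k >> = h k.
Proof.
rewrite (@lextEw h _ [fset k]%fset) ?msuppU_le // big_seq_fset1.
by rewrite mcoeffUU scale1r.
Qed.

Lemma malg_linear_eq (f g : {malg K[T]} -> V) : linear f -> linear g ->
  (forall k, f << k >> = g << k >>) -> f =1 g.
Proof.
move=> lf lg fg u.
pose f' : {linear _ -> _} := HB.pack f (GRing.isLinear.Build _ _ _ _ f lf).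
pose g' : {linear _ -> _} := HB.pack g (GRing.isLinear.Build _ _ _ _ g lg).
have fE : f =1 f' by []. have gE : g =1 g' by [].
rewrite fE gE (monalgE u) !linear_sum; apply: eq_bigr => k _.
have -> : << u@_k *g k >> = u@_k *: << k >> :> {malg K[T]}.
  by apply/malgP => k'; rewrite mcoeffZ !mcoeffU mulrnAr mulr1.
by rewrite !linearZ /= fg.
Qed.

End LinearExtension.

Definition is_hook_key (p : seq nat * seq nat) : bool :=
  [&& sorted leq p.1, sorted leq p.2, p.1 != [::] & p.2 != [::]].

Definition hook_key : Type := {p : seq nat * seq nat | is_hook_key p}.
HB.instance Definition _ := Choice.on hook_key.
Definition base_key : Type := (nat + hook_key)%type.
HB.instance Definition _ := Choice.on base_key.

Definition lkey (k : base_key) : seq nat * seq nat :=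
  match k with inl i => ([:: i], [::]) | inr p => val p end.
Definition rkey (k : base_key) : seq nat * seq nat :=
  match k with inl i => ([::], [:: i]) | inr p => val p end.

Lemma sort_neq0 (s : seq nat) : (sort leq s != [::]) = (s != [::]).
Proof. by rewrite -!size_eq0 size_sort. Qed.

Lemma cat_neq0 (s t : seq nat) :
  (s ++ t != [::]) = (s != [::]) || (t != [::]).
Proof. by case: s. Qed.

Lemma sort_key_subproof (p : seq nat * seq nat) :
  (p.1 != [::]) && (p.2 != [::]) -> is_hook_key (sort leq p.1, sort leq p.2).
Proof.
by move=> /andP[p1 p2]; rewrite /is_hook_key /= !sort_neq0 p1 p2
  !(sort_sorted leq_total).
Qed.

Lemma key_mul_subproof (s t : base_key) :
  is_hook_key (sort leq ((lkey s).1 ++ (rkey t).1),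
               sort leq ((lkey s).2 ++ (rkey t).2)).
Proof.
apply: (@sort_key_subproof (_, _)) => /=.
case: s t => [i|[[a b] /= /and4P[_ _ /= a0 b0]]];
  case=> [j|[[c d] /= /and4P[_ _ /= c0 d0]]]; rewrite //= ?cat_neq0 //.
- by rewrite a0 orbT.
- by rewrite a0 b0.
Qed.

Definition key_mul : base_key -> base_key -> base_key :=
  locked (fun s t => inr (Sub (_, _) (key_mul_subproof s t))).

Lemma key_mulE s t : key_mul s t = inr (Sub (_, _) (key_mul_subproof s t)).
Proof. by rewrite /key_mul -lock. Qed.

Lemma key_eq (p q : hook_key) : perm_eq (val p).1 (val q).1 ->
  perm_eq (val p).2 (val q).2 -> p = q.
Proof.
case: p q => [[a b] /= pab] [[c d] /= pcd] e1 e2; apply: val_inj => /=.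
have /and4P[/= sa sb _ _] := pab; have /and4P[/= sc sd _ _] := pcd.
by congr pair; apply: (sorted_eq leq_trans anti_leq).
Qed.

Lemma key_mulCA r s t : key_mul r (key_mul s t) = key_mul s (key_mul r t).
Proof.
rewrite !key_mulE; congr inr; apply: key_eq => /=; rewrite perm_sort perm_sym perm_sort.
- rewrite (perm_catl _ (permEl (perm_sort _ _))) perm_sym.
  by rewrite (perm_catl _ (permEl (perm_sort _ _))) perm_catCA.
- rewrite (perm_catl _ (permEl (perm_sort _ _))) perm_sym.
  by rewrite (perm_catl _ (permEl (perm_sort _ _))) perm_catCA.
Qed.

Lemma key_mulAC r s t : key_mul (key_mul r s) t = key_mul (key_mul r t) s.
Proof.
rewrite !key_mulE; congr inr; apply: key_eq => /=; rewrite perm_sort perm_sym perm_sort.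
- rewrite (perm_catr _ (permEl (perm_sort _ _))) perm_sym.
  by rewrite (perm_catr _ (permEl (perm_sort _ _))) perm_catAC.
- rewrite (perm_catr _ (permEl (perm_sort _ _))) perm_sym.
  by rewrite (perm_catr _ (permEl (perm_sort _ _))) perm_catAC.
Qed.

Section Model.
Context (K : fieldType).

Definition bicom_model : Type := {malg K[base_key]}.
HB.instance Definition _ := GRing.Lmodule.on bicom_model.

Definition model_mul : bicom_model -> bicom_model -> bicom_model :=
  locked (fun u v =>
    lext (fun s => lext (fun t => << key_mul s t >> : {malg K[base_key]}) v) u).

Lemma model_mulUU s t : model_mul << s >> << t >> = << key_mul s t >>.
Proof. by rewrite /model_mul -lock !lextU. Qed.

Lemma model_mul_linearl v : linear (model_mul^~ v).
Proof. by rewrite /model_mul -lock; exact: lext_is_linear. Qed.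

Lemma model_mul_linearr u : linear (model_mul u).
Proof.
move=> c v w; rewrite /model_mul -lock /lext scaler_sumr -big_split /=.
apply: eq_bigr => s _; rewrite scalerA mulrC -scalerA -scalerDr.
by rewrite -[in LHS]/(lext _ _) lext_is_linear.
Qed.

Lemma model_mulZDl c u v w :
  model_mul (c *: u + v) w = c *: model_mul u w + model_mul v w.
Proof. exact: model_mul_linearl. Qed.
Lemma model_mulZDr c u v w :
  model_mul w (c *: u + v) = c *: model_mul w u + model_mul w v.
Proof. exact: model_mul_linearr. Qed.

Lemma model_mulCA a b c :
  model_mul a (model_mul b c) = model_mul b (model_mul a c).
Proof.
move: a; apply: malg_linear_eq => [k u v|k u v|r].
- by rewrite model_mulZDl.
- by rewrite model_mulZDl model_mulZDr.
move: b; apply: malg_linear_eq => [k u v|k u v|s].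
- by rewrite model_mulZDl model_mulZDr.
- by rewrite model_mulZDl.
move: c; apply: malg_linear_eq => [k u v|k u v|t]; try by rewrite !model_mulZDr.
rewrite !model_mulUU; congr (<< _ >>); exact: key_mulCA.
Qed.

Lemma model_mulAC a b c :
  model_mul (model_mul a b) c = model_mul (model_mul a c) b.
Proof.
move: a; apply: malg_linear_eq => [k u v|k u v|r]; try by rewrite !model_mulZDl.
move: b; apply: malg_linear_eq => [k u v|k u v|s].
- by rewrite model_mulZDr model_mulZDl.
- by rewrite model_mulZDr.
move: c; apply: malg_linear_eq => [k u v|k u v|t].
- by rewrite model_mulZDr.
- by rewrite model_mulZDr model_mulZDl.
rewrite !model_mulUU; congr (<< _ >>); exact: key_mulAC.
Qed.

HB.instance Definition _ := Lmodule_isBicomAlg.Build K bicom_model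
  model_mul_linearl model_mul_linearr model_mulCA model_mulAC.

Definition model_gen (i : nat) : bicom_model := << (inl i : base_key) >>.

Definition mk_key a b (e : (a != [::]) && (b != [::])) : base_key :=
  inr (Sub (_, _) (@sort_key_subproof (a, b) e)).

Lemma model_hook a b (e : (a != [::]) && (b != [::])) :
  hookS model_gen a b = << mk_key e >> :> bicom_model.
Proof.
case: a e => // a1 a e; have [_ b0] := andP e.
elim/last_ind: a e => [|a c IH] e.
  elim/last_ind: b b0 e => [b0|b d IH _] e; first by case/eqP: b0.
  have [b0|bn] := eqVneq b [::].
    subst b; have -> : hookS model_gen [:: a1] (rcons [::] d) =
                bmul (model_gen a1) (model_gen d) by [].
    rewrite [LHS]model_mulUU; congr (<< _ >>); rewrite key_mulE; congr inr.
    exact: key_eq.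
  have e' : ([:: a1] != [::]) && (b != [::]) by [].
  have -> : hookS model_gen [:: a1] (rcons b d) =
            bmul (hookS model_gen [:: a1] b) (model_gen d).
    by rewrite /= /rmuls foldl_rcons.
  rewrite (IH bn e') [LHS]model_mulUU; congr (<< _ >>); rewrite key_mulE; congr inr.
  apply: key_eq => /=; first by rewrite perm_sort.
  rewrite perm_sort perm_sym perm_sort perm_rcons perm_sym -cat1s perm_catC.
  by rewrite perm_cat2l perm_sort.
have e' : (a1 :: a != [::]) && (b != [::]) by [].
have -> : hookS model_gen (a1 :: rcons a c) b =
          bmul (model_gen c) (hookS model_gen (a1 :: a) b).
  by rewrite /= /lmuls foldl_rcons.
rewrite (IH e') [LHS]model_mulUU; congr (<< _ >>); rewrite key_mulE; congr inr.
apply: key_eq => /=; last by rewrite perm_sort.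
rewrite perm_sort perm_sym perm_sort -rcons_cons perm_rcons perm_sym.
by rewrite -cat1s -[c :: a1 :: a]cat1s perm_cat2l perm_sort.
Qed.

Lemma model_hook_key (p : hook_key) :
  hookS model_gen (val p).1 (val p).2 = << (inr p : base_key) >>.
Proof.
case: p => [[a b] pab] /=; have /and4P[/= sa sb a0 b0] := pab.
have e : (a != [::]) && (b != [::]) by rewrite a0.
rewrite (model_hook e); congr (<< _ >>); congr inr.
by apply: key_eq; rewrite /= perm_sort.
Qed.

Definition model_val (V : lmodType K) (g : nat -> V)
    (h : seq nat -> seq nat -> V) (k : base_key) : V :=
  match k with inl i => g i | inr p => h (val p).1 (val p).2 end.

Lemma model_free : free_bicom model_gen.
Proof.
split=> [A y|A phi psi phiM psiM e].
  pose h := model_val y (hookS y); pose phi : {linear bicom_model -> A} := lext h.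
  exists phi; last by move=> i; rewrite /phi /= lextU.
  have hM s t : h (key_mul s t) = bmul (h s) (h t).
    rewrite key_mulE /h; case: s t => [i|[[a b] /= pab]] [j|[[c d] /= pcd]] /=.
    - by [].
    - have /and4P[/= _ _ c0 d0] := pcd.
      rewrite gen_mul_hookS // (@hookS_perml _ _ _ _ (i :: c)) ?sort_neq0 //.
        by apply: hookS_permr; rewrite perm_sort.
      by rewrite perm_sort.
    - have /and4P[/= _ _ a0 b0] := pab.
      rewrite hookS_mul_gen // (@hookS_perml _ _ _ _ a) ?sort_neq0 //.
      + by apply: hookS_permr; rewrite perm_sort cats1.
      + by rewrite cat_neq0 orbT.
      + by rewrite perm_sort cats0.
    have /and4P[/= _ _ a0 b0] := pab; have /and4P[/= _ _ c0 d0] := pcd.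
    rewrite hookS_mul_hookS // (@hookS_perml _ _ _ _ (a ++ c)) ?sort_neq0 //.
    + by apply: hookS_permr; rewrite perm_sort.
    + by rewrite cat_neq0 b0.
    + by rewrite perm_sort.
  move=> u v; move: u; apply: malg_linear_eq => [k u w|k u w|s].
  - by rewrite (bmul_linearl v) linearP.
  - by rewrite linearP (bmul_linearl (phi v)).
  move: v; apply: malg_linear_eq => [k u w|k u w|t].
  - by rewrite bmul_linearr linearP.
  - by rewrite linearP bmul_linearr.
  by rewrite [X in phi X]model_mulUU /phi /= !lextU.
apply: malg_linear_eq => [||[i|p]]; [exact: linearP|exact: linearP|exact: e|].
rewrite -model_hook_key (hook_word_hom phiM (y := psi \o model_gen)) //.
by rewrite (hook_word_hom psiM (y := psi \o model_gen)).
Qed.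

End Model.

Theorem free_bicom_exists (K : fieldType) :
  exists (B : bicomAlgType K) (x : nat -> B), free_bicom x.
Proof. by exists (bicom_model K), (@model_gen K); exact: model_free. Qed.

Lemma free_bicom_model (K : fieldType) (B : bicomAlgType K) (x : nat -> B) :
  free_bicom x ->
  exists (phi : {linear B -> bicom_model K}) (psi : {linear bicom_model K -> B}),
    [/\ cancel phi psi,
        forall i, phi (x i) = model_gen K i,
        forall a b, phi (hookS x a b) = hookS (model_gen K) a b,
        forall i, psi (model_gen K i) = x i
      & forall a b, psi (hookS (model_gen K) a b) = hookS x a b].
Proof.
move=> [exB unB]; have [exM _] := @model_free K.
have [phi phiM phix] := exB _ (model_gen K).
have [psi psiM psix] := exM _ x.
exists phi, psi; split=> //; last 2 first.
- exact: (hook_word_hom phiM).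
- exact: (hook_word_hom psiM).
move=> u; have := unB _ (psi \o phi : {linear B -> B}) (idfun : {linear B -> B}).
by apply=> [v w|v w|i] //=; rewrite ?phiM ?psiM ?phix ?psix.
Qed.

Theorem base_elements_basis (K : fieldType) (B : bicomAlgType K)
    (x : nat -> B) (freeB : free_bicom x) (V : lmodType K) :
  (forall (g : nat -> V) (h : nat -> seq nat -> nat -> seq nat -> V),
     exists F : {linear B -> V}, (forall i, F (x i) = g i) /\
       (forall a1 a b1 b, base_index a1 a b1 b ->
          F (hook x a1 a b1 b) = h a1 a b1 b)) /\
  (forall F G : {linear B -> V}, (forall i, F (x i) = G (x i)) ->
     (forall a1 a b1 b, base_index a1 a b1 b ->
        F (hook x a1 a b1 b) = G (hook x a1 a b1 b)) -> F =1 G).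
Proof.
have [phi [psi [psiK phix phih psix psih]]] := free_bicom_model freeB.
split=> [g h|F G eg eh u].
  pose h' a b := if a is a1 :: a' then
                   if b is b1 :: b' then h a1 a' b1 b' else 0 else 0.
  pose L : {linear bicom_model K -> V} := lext (model_val g h').
  exists (L \o phi : {linear B -> V}); split=> [i|a1 a b1 b /andP[pa pb]] /=.
    by rewrite phix /L /= lextU.
  rewrite hookE phih.
  have ab : is_hook_key (a1 :: a, b1 :: b) by rewrite /is_hook_key /= pa pb.
  pose p : hook_key := Sub (a1 :: a, b1 :: b) ab.
  by rewrite (model_hook_key K p) /L /= lextU.
rewrite -(psiK u); move: (phi u) => {u}.
apply: malg_linear_eq => [c v w|c v w|[i|[[a b] pab]]].
- by rewrite !linearP.
- by rewrite !linearP.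
- by rewrite psix eg.
rewrite -model_hook_key psih /=.
have /and4P[/= sa sb a0 b0] := pab.
case: a {pab} sa a0 => // a1 a sa _; case: b sb b0 => // b1 b sb _.
by apply: eh; rewrite /base_index; apply/andP.
Qed.

Theorem dynkin_exists (K : fieldType) (B : bicomAlgType K) (x : nat -> B) :
  free_bicom x -> exists D : {linear B -> B}, is_dynkin x D.
Proof.
move=> freeB; have [ex _] := base_elements_basis freeB B.
by have [D [_ DE]] := ex (fun=> 0)
  (fun a1 a b1 b => 2%:R^-1 *: lie_hook x a1 a b1 b); exists D.
Qed.

Theorem head_exists (K : fieldType) (B : bicomAlgType K) (x : nat -> B) :
  free_bicom x -> exists head : {linear B -> B}, is_head x head.
Proof.
move=> freeB; have [ex _] := base_elements_basis freeB B.
by have [h hE] := ex (fun=> 0) (fun a1 a b1 b =>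
  if head_index a1 a b1 b then hook x a1 a b1 b else 0); exists h.
Qed.

(* [involves_first] cannot be omitted: the generators and the commutator of the
   second and third generators are Lie elements that D \o head kills. *)
Theorem head_degenerate (K : fieldType) (B : bicomAlgType K) (x : nat -> B)
    (D head : {linear B -> B}) :
  free_bicom x -> is_head x head ->
  (forall i, [/\ is_lie x (x i), x i <> 0 & D (head (x i)) = 0]) /\
  (let f := bcomm (x 1%N) (x 2%N) in
   [/\ is_lie x f, f <> 0 & D (head f) = 0]).
Proof.
move=> freeB [head0 headE]; have [ex _] := base_elements_basis freeB K^o.
have [F [Fx Fh]] := ex (fun=> 1) (fun a1 _ _ _ => (a1 == 1%N)%:R).
split=> [i|]; split; try by do !constructor.
- by move=> /(congr1 F)/eqP; rewrite Fx linear0 oner_eq0.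
- by rewrite head0 linear0.
- move=> /(congr1 F)/eqP; rewrite linearB linear0.
  rewrite (Fh 1%N [::] 2%N [::]) // (Fh 2%N [::] 1%N [::]) //.
  by rewrite subr0 oner_eq0.
- rewrite linearB (headE 1%N [::] 2%N [::]) // (headE 2%N [::] 1%N [::]) //.
  by rewrite subr0 linear0.
Qed.

(* Main.v *)
(* In degree at least 2 the base element e(a; b) behaves as the monomial y_a z_b
   in commuting variables: [x_c, -] multiplies it by t_c = y_c - z_c, and
   products commute with one another.  Hence the Lie elements are spanned by
   the generators and by the elements t_s [x_i, x_j]; by the Jacobi identity,
   those in which x_1 occurs are spanned by the elements t_s [x_1, x_j].  Only
   the extreme terms y_s y_1 z_j and -(-1)^|s| y_j z_1 z_s of the expansion of
   t_s [x_1, x_j] contribute to D (head -), one half of t_s [x_1, x_j] each. *)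
Require Import Defs.
From HB Require Import structures.
From mathcomp Require Import all_boot all_order all_algebra.
From mathcomp.multinomials Require Import monalg.
Import GRing.Theory.
Local Open Scope ring_scope.

Set Implicit Arguments.
Unset Strict Implicit.
Unset Printing Implicit Defensive.

(** * Linear spans, and occurrence of the index 0, that is of x_1, in lists of indices *)

Section Span.
Context (K : fieldType) (V : lmodType K).

Inductive in_span (E : V -> Prop) : V -> Prop :=
| span_gen u : E u -> in_span E u
| span_zero : in_span E 0
| span_add u v : in_span E u -> in_span E v -> in_span E (u + v)
| span_scale c u : in_span E u -> in_span E (c *: u).

Lemma span_opp E u : in_span E u -> in_span E (- u).
Proof. by rewrite -scaleN1r; exact: span_scale. Qed.

Lemma span_sum E (I : Type) (r : seq I) (F : I -> V) :
  (forall i, in_span E (F i)) -> in_span E (\sum_(i <- r) F i).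
Proof. by move=> EF; apply: big_ind => //; [exact: span_zero|exact: span_add]. Qed.

End Span.

Lemma mem0_sorted (a1 : nat) a : path leq a1 a -> (0%N \in a1 :: a) = (a1 == 0%N).
Proof.
move=> pa; rewrite inE eq_sym; case: eqP => //= /eqP a10.
apply/negbTE/negP => /(allP (order_path_min leq_trans pa)).
by rewrite leqn0 (negPf a10).
Qed.

Lemma mem_cat_consl (T : eqType) (y c : T) s a b :
  (y \in s ++ (c :: a) ++ b) = (y \in c :: s ++ a ++ b).
Proof. by rewrite !(mem_cat, inE) -!orbA orbCA. Qed.

Lemma mem_cat_consr (T : eqType) (y c : T) s a b :
  (y \in s ++ a ++ c :: b) = (y \in c :: s ++ a ++ b).
Proof.
by rewrite !(mem_cat, inE) [(y \in a) || _]orbCA [(y \in s) || _]orbCA.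
Qed.

(** * Bilinearity and the Jacobi identity *)

Section Bicommutative.
Context (K : fieldType) (B : bicomAlgType K).
Local Infix "**" := (@bmul K B) (at level 40, left associativity).
Local Notation "[ u , v ]" := (@bcomm K B u v).

HB.instance Definition _ u :=
  GRing.isLinear.Build K B B *:%R (@bmul K B u) (bmul_linearr u).

Lemma bmulDl (u v w : B) : (u + v) ** w = u ** w + v ** w.
Proof. by have := bmul_linearl w 1 u v; rewrite !scale1r. Qed.

Lemma bmul0l (w : B) : 0 ** w = 0.
Proof. by apply: (addIr (0 ** w)); rewrite -bmulDl !add0r. Qed.

Lemma bmulZl c (u w : B) : (c *: u) ** w = c *: (u ** w).
Proof. by have := bmul_linearl w c u 0; rewrite bmul0l !addr0. Qed.

Lemma bmulBl (u v w : B) : (u - v) ** w = u ** w - v ** w.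
Proof. by rewrite bmulDl -scaleN1r bmulZl scaleN1r. Qed.

Lemma bmulBr (w u v : B) : w ** (u - v) = w ** u - w ** v.
Proof. exact: linearB. Qed.

Lemma bcomm_linear u : linear (@bcomm K B u).
Proof.
move=> c v w; rewrite /bcomm linearP bmulDl bmulZl scalerBr opprD.
by rewrite addrACA.
Qed.

HB.instance Definition _ u :=
  GRing.isLinear.Build K B B *:%R (@bcomm K B u) (bcomm_linear u).

Lemma bcommC (u v : B) : [u, v] = - [v, u].
Proof. by rewrite /bcomm opprB. Qed.

Lemma bcommxx (u : B) : [u, u] = 0.
Proof. by rewrite /bcomm subrr. Qed.

Lemma bcommDr (w u v : B) : [w, u + v] = [w, u] + [w, v].
Proof. exact: linearD. Qed.

Lemma bcommZr c (w u : B) : [w, c *: u] = c *: [w, u].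
Proof. exact: linearZ. Qed.

Lemma bcomm0r (w : B) : [w, 0] = 0.
Proof. exact: linear0. Qed.

Lemma bcommDl (u v w : B) : [u + v, w] = [u, w] + [v, w].
Proof. by rewrite bcommC bcommDr opprD -!bcommC. Qed.

Lemma bcommZl c (u w : B) : [c *: u, w] = c *: [u, w].
Proof. by rewrite bcommC bcommZr -scalerN -bcommC. Qed.

Lemma bcomm0l (w : B) : [0, w] = 0.
Proof. by rewrite bcommC bcomm0r oppr0. Qed.

(** The two laws leave six distinct products of u, v, w; after cancellation the eight terms on the
    right are the four on the left. *)
Lemma bcomm_jacobi (u v w : B) : [u, [v, w]] = [v, [u, w]] - [w, [u, v]].
Proof.
rewrite /bcomm !bmulBr !bmulBl.
rewrite (bmulCA v u w) (bmulCA w u v) (bmulCA w v u).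
rewrite (bmulAC v w u) (bmulAC w v u) (bmulAC u w v).
set a := u ** (v ** w); set b := u ** (w ** v); set c := v ** (w ** u).
set d := v ** u ** w; set e := w ** u ** v; set g := u ** v ** w.
(* The permutation puts the four surviving terms first, then the two cancelling pairs. *)
rewrite !opprB !addrA [RHS](ACl (1*8*3*6*(7*2)*(5*4)))/=.
by rewrite !subrr !addr0.
Qed.

(** * The square of the algebra *)

Definition in_square : B -> Prop := in_span (fun u => exists v w, u = v ** w).

Lemma square_mul u v : in_square (u ** v).
Proof. by apply: span_gen; exists u, v. Qed.

Lemma square_bcomm u v : in_square [u, v].
Proof. by apply: span_add; [|apply: span_opp]; exact: square_mul. Qed.

(** Left and right multiplications commute on the square: on a product this is [bmul_assoc], and
    both sides are linear in v. *)
Lemma square_assoc u v w : in_square v -> u ** (v ** w) = (u ** v) ** w.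
Proof.
elim=> [_ [a [b ->]]||v1 v2 _ IH1 _ IH2|c v1 _ IH].
- exact: bmul_assoc.
- by rewrite bmul0l !linear0 bmul0l.
- by rewrite bmulDl !linearD /= bmulDl IH1 IH2.
- by rewrite bmulZl !linearZ /= bmulZl IH.
Qed.

(** For u = ab and v = cd both products reduce to (a(cd))b. *)
Lemma square_mulC u v : in_square u -> in_square v -> u ** v = v ** u.
Proof.
move=> squ; elim=> [_ [c [d ->]]||v1 v2 _ IH1 _ IH2|k v1 _ IH].
- elim: squ => [_ [a [b ->]]||u1 u2 _ IH1 _ IH2|k u1 _ IH].
  + rewrite [LHS]bmulCA [RHS]bmulCA (bmulAC a b d).
    by rewrite !(square_assoc _ _ (square_mul _ _)) (bmulCA c a d).
  + by rewrite bmul0l linear0.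
  + by rewrite bmulDl linearD /= IH1 IH2.
  + by rewrite bmulZl linearZ /= IH.
- by rewrite bmul0l linear0.
- by rewrite bmulDl linearD /= IH1 IH2.
- by rewrite bmulZl linearZ /= IH.
Qed.

Lemma square_bcomm0 u v : in_square u -> in_square v -> [u, v] = 0.
Proof. by move=> squ sqv; rewrite /bcomm square_mulC ?subrr. Qed.

(** The Jacobi correction [w, [u, v]] vanishes, being a commutator of two elements of the square. *)
Lemma bcommCA u v w : in_square w -> [u, [v, w]] = [v, [u, w]].
Proof.
by move=> sqw; rewrite bcomm_jacobi (square_bcomm0 sqw (square_bcomm _ _)) subr0.
Qed.

(** * Iterated commutators with generators: [ads s] realizes multiplication by t_s *)

Section Generators.
Context (x : nat -> B).

Definition ads (s : seq nat) (u : B) : B := foldl (fun u c => [x c, u]) u s.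

Lemma ads_linear s : linear (ads s).
Proof.
by move=> c u v; elim: s u v => //= d s IH u v; rewrite bcommDr bcommZr IH.
Qed.

HB.instance Definition _ s :=
  GRing.isLinear.Build K B B *:%R (ads s) (ads_linear s).

Lemma adsB s u v : ads s (u - v) = ads s u - ads s v.
Proof. exact: linearB. Qed.

Lemma adsZ s c u : ads s (c *: u) = c *: ads s u.
Proof. exact: linearZ. Qed.

Lemma ads_cat s t u : ads (s ++ t) u = ads t (ads s u).
Proof. exact: foldl_cat. Qed.

Lemma ads_rcons s i u : [x i, ads s u] = ads (rcons s i) u.
Proof. by rewrite /ads foldl_rcons. Qed.

Lemma square_ads s u : in_square u -> in_square (ads s u).
Proof.
by elim: s u => //= c s IH u _; apply/IH/square_bcomm.
Qed.

Lemma ads_bcomm s c u : in_square u -> ads s [x c, u] = [x c, ads s u].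
Proof.
elim: s u => //= d s IH u squ.
by rewrite bcommCA // IH //; exact: square_bcomm.
Qed.

Lemma ads_perm s t u : in_square u -> perm_eq s t -> ads s u = ads t u.
Proof.
elim: s t u => [|c s IH] t u squ pst.
  by move: pst; rewrite perm_sym => /perm_nilP ->.
have ct : c \in t by rewrite -(perm_mem pst) mem_head.
case/splitPr: ct pst => t1 t2; rewrite perm_sym -cat1s perm_catCA /= perm_cons.
rewrite perm_sym => pst; rewrite (IH _ _ (square_bcomm _ _) pst).
by rewrite !ads_cat /= ads_bcomm.
Qed.

(** Each entry of [b] brackets from the right, and turning it to the left costs a sign; the order of
    the brackets is then immaterial. *)
Lemma lie_hookE a1 a b1 b :
  lie_hook x a1 a b1 b = (-1) ^+ size b *: ads (a ++ b) [x a1, x b1].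
Proof.
have pC : perm_eq (a ++ b) (b ++ a) by rewrite perm_catC.
rewrite (ads_perm (square_bcomm _ _) pC) ads_cat -adsZ.
rewrite [lie_hook _ _ _ _ _]/(ads a _); congr ads.
elim: b [x a1, x b1] {pC} => [|d b IH] u; first by rewrite scale1r.
rewrite [LHS]/= IH [size _]/= exprSr -scalerA; congr (_ *: _).
by rewrite [ads (d :: b) u]/= -adsZ scaleN1r -bcommC.
Qed.

Lemma is_lie_ads s u : is_lie x u -> is_lie x (ads s u).
Proof.
by elim: s u => //= c s IH u lu; apply/IH/lie_bracket => //; exact: lie_gen.
Qed.

(** * A spanning set of the Lie elements *)

Inductive lie_monomial : B -> Prop :=
| lie_monomial_gen i : lie_monomial (x i)
| lie_monomial_ads s i j : lie_monomial (ads s [x i, x j]).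

(** If one factor is a generator, it lengthens the other monomial up to sign; otherwise both lie in
    the square and the bracket is 0. *)
Lemma lie_monomial_bcomm u v :
  lie_monomial u -> lie_monomial v -> in_span lie_monomial [u, v].
Proof.
case=> [i|s i j] [k|t k l].
- by apply: span_gen; exact: (lie_monomial_ads [::]).
- by rewrite ads_rcons; apply: span_gen; constructor.
- rewrite bcommC ads_rcons; apply: span_opp.
  by apply: span_gen; constructor.
- rewrite square_bcomm0; [exact: span_zero|..];
    by apply: square_ads; exact: square_bcomm.
Qed.

Lemma is_lie_span u : is_lie x u -> in_span lie_monomial u.
Proof.
elim=> {u} [i||u v _ IHu _ IHv|c u _ IHu|u v _ IHu _ IHv].
- by apply: span_gen; constructor.
- exact: span_zero.
- exact: span_add.
- exact: span_scale.
elim: IHu => [{}u lu||u1 u2 _ IH1 _ IH2|c u1 _ IH].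
- elim: IHv => [{}v lv||v1 v2 _ IH1 _ IH2|c v1 _ IH].
  + exact: lie_monomial_bcomm.
  + by rewrite bcomm0r; exact: span_zero.
  + by rewrite bcommDr; exact: span_add.
  + by rewrite bcommZr; exact: span_scale.
- by rewrite bcomm0l; exact: span_zero.
- by rewrite bcommDl; exact: span_add.
- by rewrite bcommZl; exact: span_scale.
Qed.

(** * Hooks with unsorted indices, and the expansion of Lie monomials into hooks *)

Lemma bcomm_hookS c a b : a != [::] -> b != [::] ->
  [x c, hookS x a b] = hookS x (c :: a) b - hookS x a (c :: b).
Proof.
move=> a0 b0; rewrite /bcomm gen_mul_hookS // hookS_mul_gen //.
by congr (_ - _); apply: hookS_permr; rewrite perm_rcons.
Qed.

Lemma bcomm_gen i j :
  [x i, x j] = hookS x [:: i] [:: j] - hookS x [:: j] [:: i].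
Proof. by []. Qed.

(** Transfers to arbitrary index lists what [D], [head] and [involves_first] specify on sorted ones
    only. *)
Lemma hookS_sorted a b : a != [::] -> b != [::] ->
  exists a1 a' b1 b', [/\ base_index a1 a' b1 b', perm_eq a (a1 :: a'),
    perm_eq b (b1 :: b') & hookS x a b = hook x a1 a' b1 b'].
Proof.
move=> a0 b0; have: sorted leq (sort leq a) by exact: (sort_sorted leq_total).
have: sorted leq (sort leq b) by exact: (sort_sorted leq_total).
have: sort leq a != [::] by rewrite sort_neq0.
have: sort leq b != [::] by rewrite sort_neq0.
have pa : perm_eq a (sort leq a) by rewrite perm_sym perm_sort.
have pb : perm_eq b (sort leq b) by rewrite perm_sym perm_sort.
case: (sort leq a) (sort leq b) pa pb => [//|a1 a'] [//|b1 b'] pa pb _ _ sb sa.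
exists a1, a', b1, b'; split=> //; first by rewrite /base_index; apply/andP.
by rewrite hookE (hookS_perml _ b0 pa) (hookS_permr _ _ pb).
Qed.

Lemma involves_hookS a b : a != [::] -> b != [::] -> 0%N \in a ++ b ->
  involves_first x (hookS x a b).
Proof.
move=> a0 b0; have [a1 [a' [b1 [b' [ab pa pb ->]]]]] := hookS_sorted a0 b0.
have /andP[sa sb] := ab.
rewrite mem_cat (perm_mem pa) (perm_mem pb) !mem0_sorted //.
exact: inv_base.
Qed.

Lemma involves_sub u v :
  involves_first x u -> involves_first x v -> involves_first x (u - v).
Proof.
by move=> iu iv; apply: inv_add => //; rewrite -scaleN1r; exact: inv_scale.
Qed.

(** A bracket with x_c moves c into the column or the row, so every hook of the expansion keeps the
    multiset of indices. *)
Lemma involves_ads s a b : a != [::] -> b != [::] -> 0%N \in s ++ a ++ b ->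
  involves_first x (ads s (hookS x a b)).
Proof.
elim: s a b => [|c s IH] a b a0 b0 sab /=; first exact: involves_hookS.
rewrite bcomm_hookS // adsB; apply: involves_sub; apply: IH => //.
  by rewrite mem_cat_consl.
by rewrite mem_cat_consr.
Qed.

Lemma involves_ads_bcomm s i j : 0%N \in [:: i, j & s] ->
  involves_first x (ads s [x i, x j]).
Proof.
move=> sij; rewrite bcomm_gen adsB; apply: involves_sub; apply: involves_ads => //;
  by move: sij; rewrite !(mem_cat, inE) -?orbA => /or3P[->|->|->]; rewrite ?orbT.
Qed.

Lemma base_span : free_bicom x -> forall u, in_span (fun v =>
  (exists i, v = x i) \/
  (exists a1 a b1 b, base_index a1 a b1 b /\ v = hook x a1 a b1 b)) u.
Proof.
move=> freeB u.
have [phi [psi [phiK _ _ psix psih]]] := free_bicom_model freeB.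
have psiE : psi =1 lext (fun k => psi << k >>).
  by apply: malg_linear_eq => [||k]; [exact: linearP..|rewrite lextU].
rewrite -(phiK u) psiE; apply: span_sum => k; apply: span_scale.
apply: span_gen; case: k => [i|p]; first by left; exists i; exact: psix.
right; rewrite -model_hook_key psih; case: p => [[a b] pab] /=.
move: (pab) => /and4P[/=]; case: a b {pab} => [|a1 a] [|b1 b] // pa pb _ _.
by exists a1, a, b1, b; split=> //; apply/andP.
Qed.


(** * The values of [D] after [head] on Lie monomials *)

Section DynkinHead.
Local Arguments hookS : simpl never.
Hypothesis (two_neq0 : 2%:R != 0 :> K) (freeB : free_bicom x).
Context (D head : {linear B -> B}).
Hypothesis (dynkinD : is_dynkin x D) (headP : is_head x head).

(** After sorting, 0 stands first as soon as it occurs, so membership replaces the test on the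
    leading index. *)
Lemma head_hookS a b : a != [::] -> b != [::] ->
  head (hookS x a b) =
    if (size a == 1%N) && (0%N \in b) || (size b == 1%N) && (0%N \in a)
    then hookS x a b else 0.
Proof.
move=> a0 b0; have [a1 [a' [b1 [b' [ab pa pb ->]]]]] := hookS_sorted a0 b0.
have [_ headE] := headP; have /andP[sa sb] := ab; rewrite headE //.
rewrite (perm_mem pa) (perm_mem pb) (perm_size pa) (perm_size pb) /=.
by rewrite !mem0_sorted // !eqSS !size_eq0.
Qed.

Lemma dynkin_head_col s j :
  D (head (hookS x (0%N :: s) [:: j])) = 2%:R^-1 *: ads s [x 0%N, x j].
Proof.
rewrite head_hookS //= mem_head orbT.
have ps : perm_eq (0%N :: s) (0%N :: sort leq s).
  by rewrite perm_cons perm_sym perm_sort.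
rewrite (hookS_perml _ _ ps) // -[hookS _ _ _]/(hook x 0%N (sort leq s) j [::]).
rewrite dynkinD ?lie_hookE ?scale1r ?cats0; last first.
  rewrite /base_index /= andbT path_min_sorted ?(sort_sorted leq_total) //.
  exact/allP.
congr (_ *: _); apply: ads_perm; first exact: square_bcomm.
by rewrite perm_sort.
Qed.

Lemma dynkin_head_row s i :
  D (head (hookS x [:: i] (0%N :: s))) =
    2%:R^-1 *: ((-1) ^+ size s *: ads s [x i, x 0%N]).
Proof.
rewrite head_hookS //=.
have ps : perm_eq (0%N :: s) (0%N :: sort leq s).
  by rewrite perm_cons perm_sym perm_sort.
rewrite (hookS_permr _ _ ps) -[hookS _ _ _]/(hook x i [::] 0%N (sort leq s)).
rewrite dynkinD ?lie_hookE ?size_sort; last first.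
  rewrite /base_index /= path_min_sorted ?(sort_sorted leq_total) //.
  exact/allP.
congr (_ *: (_ *: _)); apply: ads_perm; first exact: square_bcomm.
by rewrite perm_sort.
Qed.

(** Brackets never shorten a column or a row, so no head shape can arise. *)
Lemma head_ads_inner s a b : (1 < size a)%N -> (1 < size b)%N ->
  head (ads s (hookS x a b)) = 0.
Proof.
elim: s a b => [|c s IH] a b sa sb /=.
  rewrite head_hookS -?size_eq0 -?lt0n ?(ltnW sa) ?(ltnW sb) //.
  by rewrite !gtn_eqF.
rewrite bcomm_hookS -?size_eq0 -?lt0n ?(ltnW sa) ?(ltnW sb) //.
by rewrite adsB linearB /= !IH ?subrr //= ltnS ltnW.
Qed.

(** An index sent to the row makes both sides longer than 1, which [head] kills; only the term with
    all of [s] in the column survives. *)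
Lemma head_ads_col s a j : (1 < size a)%N ->
  head (ads s (hookS x a [:: j])) = head (hookS x (s ++ a) [:: j]).
Proof.
elim: s a => [|c s IH] a sa //=.
rewrite bcomm_hookS -?size_eq0 -?lt0n ?(ltnW sa) //.
rewrite adsB linearB /= (@head_ads_inner s a [:: c; j]) // subr0 IH ?ltnS 1?ltnW //.
congr (head _); apply: hookS_perml => //.
by rewrite -[c :: a]cat1s -cat1s perm_catCA.
Qed.

Lemma head_ads_row s i b : (1 < size b)%N ->
  head (ads s (hookS x [:: i] b)) =
    (-1) ^+ size s *: head (hookS x [:: i] (s ++ b)).
Proof.
elim: s b => [|c s IH] b sb /=; first by rewrite scale1r.
rewrite bcomm_hookS -?size_eq0 -?lt0n ?(ltnW sb) //.
rewrite adsB linearB /= head_ads_inner // sub0r IH ?ltnS 1?ltnW //.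
rewrite exprS -scalerA scaleN1r; congr (- (_ *: head _)).
apply: hookS_permr.
by rewrite -[c :: b]cat1s -[c :: s ++ b]cat1s perm_catCA.
Qed.

(** The first bracket chooses column or row, and the rest must follow. For empty [s] the two terms
    would coincide and be counted twice. *)
Lemma head_ads s i j : s != [::] -> head (ads s (hookS x [:: i] [:: j])) =
  head (hookS x (i :: s) [:: j]) + (-1) ^+ size s *: head (hookS x [:: i] (j :: s)).
Proof.
case: s => // c s _ /=; rewrite bcomm_hookS // adsB linearB /=.
rewrite head_ads_col // head_ads_row // exprS -scalerA scaleN1r.
have pS k : perm_eq (s ++ [:: c; k]) [:: k, c & s].
  by rewrite perm_catC (perm_catCA [:: c] [:: k] s).
by rewrite (hookS_perml _ _ (pS i)) // (hookS_permr _ _ (pS j)).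
Qed.

Lemma dynkin_head_ads0 s j : D (head (ads s [x 0%N, x j])) = ads s [x 0%N, x j].
Proof.
set f := ads _ _; have half : 2%:R^-1 *: f + 2%:R^-1 *: f = f.
  by rewrite -scalerDl -mulr2n -(mulr_natr 2%:R^-1) mulVf // scale1r.
(* The other two extreme terms, here and in [col0]: either [head] kills them, or 0 lies in both
   column and row and [D] starts from [x_1, x_1] = 0. *)
have row0 b : b != [::] -> D (head (hookS x [:: 0%N] (j :: b))) = 0.
  move=> b0; have [jb|jb] := boolP (0%N \in j :: b); last first.
    by rewrite head_hookS //= (negPf jb) eqSS size_eq0 (negPf b0) linear0.
  rewrite (hookS_permr _ _ (perm_to_rem jb)) dynkin_head_row bcommxx.
  by rewrite [ads _ 0]linear0 !scaler0.
have col0 a : a != [::] -> D (head (hookS x (j :: a) [:: 0%N])) = 0.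
  move=> a0; have [ja|ja] := boolP (0%N \in j :: a); last first.
    by rewrite head_hookS //= (negPf ja) eqSS size_eq0 (negPf a0) linear0.
  rewrite (hookS_perml _ _ (perm_to_rem ja)) // dynkin_head_col bcommxx.
  by rewrite [ads _ 0]linear0 scaler0.
rewrite {1}/f bcomm_gen adsB (linearB head) (linearB D).
(* For empty [s] the two hooks of [x_1, x_j] are themselves head elements, contributing one half
   each. *)
have [s0|sn0] := eqVneq s [::].
  rewrite s0 [ads _ _]/= [ads _ (hookS x [:: j] _)]/=.
  rewrite dynkin_head_col dynkin_head_row scale1r /=.
  by rewrite (bcommC (x j)) scalerN opprK -[RHS]half /f s0.
rewrite !head_ads // !(linearD D) !linearZ_LR /= row0 // col0 // scaler0.
rewrite addr0 add0r.
rewrite dynkin_head_col dynkin_head_row (bcommC (x j)).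
rewrite [ads s (- _)]linearN !scalerN opprK -[RHS]half; congr (_ + _).
(* The sign of the row term in the expansion cancels the sign produced by [D]. *)
by rewrite scalerA mulrC -scalerA [X in _ *: X]scalerA -expr2 sqrr_sign scale1r.
Qed.

Lemma dynkin_head_ads s i j :
  D (head (ads s [x i, x j])) =
    if 0%N \in [:: i, j & s] then ads s [x i, x j] else 0.
Proof.
have col0 t k : D (head (ads t [x k, x 0%N])) = ads t [x k, x 0%N].
  by rewrite bcommC [ads t (- _)]linearN !linearN /= dynkin_head_ads0.
rewrite !inE; case: eqP => [<-|/eqP i0] /=; first exact: dynkin_head_ads0.
case: eqP => [<-|/eqP j0] /=; first exact: col0.
(* With x_1 moved next to [x_i, x_j], Jacobi gives two monomials with innermost brackets [x_1, x_j]
   and [x_1, x_i]. *)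
have [s0|s0] := boolP (0%N \in s).
  have pr := perm_to_rem s0; rewrite (ads_perm (square_bcomm _ _) pr) /=.
  have E k l : ads (rem 0%N s) [x k, [x 0%N, x l]] =
      ads (k :: rem 0%N s) [x 0%N, x l] by [].
  rewrite bcomm_jacobi adsB !E (linearB head) (linearB D).
  by rewrite !dynkin_head_ads0.
(* Without the index 0, every hook in the expansion is killed by [head]. *)
suff headE t a b : a != [::] -> b != [::] -> 0%N \notin t ++ a ++ b ->
    head (ads t (hookS x a b)) = 0.
  by rewrite bcomm_gen adsB !linearB /= !headE ?subrr ?linear0 //;
    rewrite !(mem_cat, inE) !negb_or; apply/and3P.
elim: t a b => [|c t IH] a b a0 b0 tab /=.
  rewrite head_hookS //; move: tab; rewrite /= mem_cat negb_or.
  by move=> /andP[/negPf-> /negPf->]; rewrite !andbF.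
rewrite bcomm_hookS // adsB (linearB head) /= !IH ?subrr //.
  by rewrite mem_cat_consr.
by rewrite mem_cat_consl.
Qed.

(** * The two implications *)

Lemma involves_dynkin_head u : is_lie x u -> involves_first x u -> D (head u) = u.
Proof.
have [ex _] := base_elements_basis freeB B.
(* D \o head and the projection P onto the base elements in which x_1 occurs
   agree on the Lie monomials, hence on all Lie elements. *)
have [P [Px Ph]] := ex (fun=> 0) (fun a1 a b1 b =>
  if (a1 == 0%N) || (b1 == 0%N) then hook x a1 a b1 b else 0).
have PhookS a b : a != [::] -> b != [::] ->
    P (hookS x a b) = if 0%N \in a ++ b then hookS x a b else 0.
  move=> a0 b0; have [a1 [a' [b1 [b' [ab pa pb ->]]]]] := hookS_sorted a0 b0.
  have /andP[sa sb] := ab; rewrite Ph // mem_cat (perm_mem pa) (perm_mem pb).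
  by rewrite !mem0_sorted.
have Pads s a b : a != [::] -> b != [::] -> P (ads s (hookS x a b)) =
    if 0%N \in s ++ a ++ b then ads s (hookS x a b) else 0.
  elim: s a b => [|c s IH] a b a0 b0; first exact: PhookS.
  rewrite [ads _ _]/= bcomm_hookS // adsB linearB /= !IH //.
  rewrite mem_cat_consl mem_cat_consr.
  by case: ifP; rewrite ?subrr.
have PE : involves_first x u -> P u = u.
  elim=> [a1 a b1 b ab e||v w _ IHv _ IHw|c v _ IH].
  - by rewrite Ph // e.
  - by rewrite linear0.
  - by rewrite linearD /= IHv IHw.
  - by rewrite linearZ /= IH.
(* The goal becomes [D (head (P u)) = P u], which is linear in [u] and can be checked on single
   monomials, even those without x_1. *)
move=> /is_lie_span lu /PE <-; elim: lu => [_ [i|s i j]||v w _ IHv _ IHw|c v _ IH].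
- by rewrite Px !linear0.
- have -> : P (ads s [x i, x j]) =
      if 0%N \in [:: i, j & s] then ads s [x i, x j] else 0.
    rewrite bcomm_gen adsB linearB /= !Pads //.
    have e k l : (0%N \in s ++ [:: k] ++ [:: l]) = (0%N \in [:: k, l & s]).
      by rewrite !(mem_cat, inE) orbC orbA.
    rewrite !e !inE orbCA; case: ifP => _; first by [].
    by rewrite subrr.
  case: ifP => h; last by rewrite !linear0.
  by rewrite dynkin_head_ads h.
- by rewrite !linear0.
- by rewrite !linearD /= IHv IHw.
- by rewrite !linearZ /= IH.
Qed.

(** By linearity base elements suffice, and [D] sends a head element to a multiple of an iterated
    commutator containing x_1. *)
Lemma dynkin_head_lie u : is_lie x (D (head u)) /\ involves_first x (D (head u)).
Proof.
have [headx headE] := headP.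
elim: (base_span freeB u) => [_ [[i ->]|[a1 [a [b1 [b [ab ->]]]]]]
    ||v w _ [lv iv] _ [lw iw]|c v _ [lv iv]].
- by rewrite headx linear0; split; constructor.
- rewrite headE //; case: ifP => h; last by rewrite linear0; split; constructor.
  rewrite dynkinD // lie_hookE; split.
    do 2!apply: lie_scale; apply: is_lie_ads.
    by apply: lie_bracket; exact: lie_gen.
  do 2!apply: inv_scale; apply: involves_ads_bcomm.
  by move: h; rewrite /head_index !inE => /orP[] /andP[_ /eqP->]; rewrite ?orbT.
- by rewrite !linear0; split; constructor.
- by rewrite !linearD; split; constructor.
- by rewrite !linearZ; split; constructor.
Qed.

End DynkinHead.
End Generators.
End Bicommutative.

Unset Implicit Arguments.

Theorem theorem2p6 (K : fieldType) (charK : [pchar K] =i pred0)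
    (B : bicomAlgType K) (x : nat -> B) (freeB : free_bicom x)
    (D head : {linear B -> B}) (dynkinD : is_dynkin x D)
    (headP : is_head x head) (f : B) :
  is_lie x f /\ involves_first x f <-> D (head f) = f.
Proof.
have two_neq0 : 2%:R != 0 :> K.
  by have := charK 2%N; rewrite !inE /= => ->.
split=> [[lf vf]|<-]; last exact: (dynkin_head_lie freeB dynkinD headP).
exact: (involves_dynkin_head two_neq0 freeB dynkinD headP).
Qed.
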